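(* Let $(X,\mathcal{B},\mu,T)$ be an invertible ergodic measure-preserving system over a probability space, and let $A:\mathbb{Z}\times X\to O_2(\mathbb{R})$ be a measurable matrix cocycle over $T$. Let $R:X\times\mathbb{Z}_2\to X\times\mathbb{Z}_2$ and $S:X\times\mathbb{T}\to X\times\mathbb{T}$ be the skew products associated with $A$ (defined in the context), where $X\times\mathbb{Z}_2$ carries the measure $\mu\times c$ and $X\times\mathbb{T}$ carries the measure $\mu\times\lambda$. Then: \begin{enumerate} \item If $S$ is ergodic, then $X\times\mathbb{R}^2$ is irreducible under the action of $A$. \item If both $R$ and $S$ are ergodic, then $X\times\mathbb{C}^2$ is irreducible under the action of $A$. \item If at least one of $R$ or $S$ is ergodic, then $A$ is not cohomologous to a cocycle whose generator has the form $\lambda(x)I$, i.e. to a scalar multiple of the identity: there are no measurable $C:X\to GL_2(\mathbb{C})$ and measurable $\lambda:X\to\mathbb{C}$ such that $C(T(x))^{-1}A(1,x)C(x)=\lambda(x)I$ for all $x$ in a set of full measure. \end{enumerate}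
   Context: Cocycle: given a measurable generator $A_0:X\to O_2(\mathbb{R})$ (real $2\times 2$ orthogonal matrices), the cocycle is $A(0,x)=I$, $A(n,x)=A_0(T^{n-1}(x))\cdots A_0(T(x))A_0(x)$ and $A(-n,x)=A_0(T^{-n}(x))^{-1}\cdots A_0(T^{-1}(x))^{-1}$ for $n>0$; so $A(1,x)=A_0(x)$. Skew products: for each $x\in X$, $A(1,x)$, acting on $\mathbb{R}^2$, is either a (counterclockwise) rotation by some angle $\alpha_x$, or the reflection in the line through the origin with angle $\beta_x$. Let $X_r\subset X$ be the set of $x$ where $A(1,x)$ is a rotation and $X_f\subset X$ the set where it is a reflection. Put $\mathbb{T}=\mathbb{R}/\mathbb{Z}$, $\mathbb{Z}_2=\mathbb{Z}/2\mathbb{Z}$, and define $f_x:\mathbb{T}\to\mathbb{T}$ by $f_x(y)=y+\alpha_x/\pi$ if $x\in X_r$ and $f_x(y)=2\beta_x/\pi-y$ if $x\in X_f$; define $g_x:\mathbb{Z}_2\to\mathbb{Z}_2$ by $g_x(a)=a$ if $x\in X_r$ and $g_x(a)=a+1$ if $x\in X_f$. Then $R(x,a)=(T(x),g_x(a))$ and $S(x,y)=(T(x),f_x(y))$. Here $c$ is normalized counting measure on $\mathbb{Z}_2$ and $\lambda$ (as a measure) is Lebesgue measure on $\mathbb{T}$; $R$ and $S$ are measure-preserving. Bundles: let $\mathbb{F}$ be $\mathbb{R}$ or $\mathbb{C}$. An invariant (measurable) vector bundle in $X\times\mathbb{F}^2$ for $A$ is given by a measurable map $x\mapsto V(x)$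 into subspaces of $\mathbb{F}^2$ (measurable with respect to the Grassmannian) for which there is a $T$-invariant set $\tilde X\subset X$ of full measure such that $A(1,x)V(x)=V(T(x))$ for all $x\in\tilde X$. An invariant bundle $V$ is reducible under the action of $A$ if there is an invariant vector bundle $W$ with $\{0\}\subsetneq W(x)\subsetneq V(x)$ for $\mu$-a.e. $x$; otherwise it is irreducible. $X\times\mathbb{F}^2$ denotes the trivial bundle $V(x)=\mathbb{F}^2$. *)

(* Defs.v *)
From HB Require Import structures.
From mathcomp Require Import all_boot all_order all_algebra.
From mathcomp Require Import generic_quotient ring_quotient complex.
From mathcomp Require Import all_classical all_reals all_analysis.

Set Implicit Arguments.
Unset Strict Implicit.
Unset Printing Implicit Defensive.

Import Order.TTheory GRing.Theory Num.Theory.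
Import numFieldNormedType.Exports.

Local Open Scope classical_set_scope.
Local Open Scope ring_scope.

Definition int_subgroup (R : realType) : zmodClosed R :=
  GRing.ZmodClosed.clone R (@Num.int_num_subdef R) _.

Definition circle (R : realType) : Type := Quotient.quot (int_subgroup R).

HB.instance Definition _ (R : realType) := GRing.Zmodule.on (circle R).
HB.instance Definition _ (R : realType) := isPointed.Build (circle R) 0.

Definition circle_proj (R : realType) : R -> circle R :=
  \pi_(Quotient.quot (int_subgroup R))%qT.

Section circle_measurable.
Variable R : realType.

(* The quotient sigma-algebra of the Borel sigma-algebra of R; it is the Borel
   sigma-algebra of R/Z. *)
Definition circle_measurable : set (set (circle R)) :=
  image_set_system setT (@circle_proj R)
    (@measurable _ (measurableTypeR R)).

Let circle_sigma_algebra : sigma_algebra setT circle_measurable.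
Proof. exact/sigma_algebra_image/sigma_algebra_measurable. Qed.

Let circle_measurable0 : circle_measurable set0.
Proof. by case: circle_sigma_algebra. Qed.

Let circle_measurableC A : circle_measurable A -> circle_measurable (~` A).
Proof. by case: circle_sigma_algebra => _ + _ => /[apply]; rewrite setTD. Qed.

Let circle_measurable_bigcup (F : (set (circle R))^nat) :
  (forall i, circle_measurable (F i)) -> circle_measurable (\bigcup_i F i).
Proof. by case: circle_sigma_algebra => _ _; apply. Qed.

HB.instance Definition _ := @isMeasurable.Build default_measure_display
  (circle R) circle_measurable circle_measurable0 circle_measurableC
  circle_measurable_bigcup.

End circle_measurable.

HB.instance Definition _ (n : nat) := isPointed.Build 'I_n.+1 ord0.
HB.instance Definition _ (n : nat) :=
  @isMeasurable.Build default_measure_display 'I_n.+1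
    discrete_measurable discrete_measurable0 discrete_measurableC
    discrete_measurableU.

Section circle_lebesgue.
Local Open Scope ereal_scope.
Variable R : realType.

Definition circle_lebesgue (B : set (circle R)) : \bar R :=
  lebesgue_measure (`[0%R, 1%R[ `&` @circle_proj R @^-1` B).

Let circle_preimage (B : set (circle R)) :
  measurable B -> measurable (@circle_proj R @^-1` B : set (measurableTypeR R)).
Proof. by rewrite /measurable/= /circle_measurable/image_set_system /= setTI. Qed.

Let circle_lebesgue0 : circle_lebesgue set0 = 0.
Proof. by rewrite /circle_lebesgue preimage_set0 setI0 measure0. Qed.

Let circle_lebesgue_ge0 B : 0 <= circle_lebesgue B.
Proof. exact: measure_ge0. Qed.

Let circle_lebesgue_sigma_additive : semi_sigma_additive circle_lebesgue.
Proof.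
move=> F mF tF mUF; rewrite /circle_lebesgue preimage_bigcup setI_bigcupr.
apply: measure_semi_sigma_additive.
- by move=> n; apply: measurableI => //; exact: circle_preimage.
- apply: trivIset_setIl; apply/trivIsetP => /= i j _ _ ij.
  rewrite -preimage_setI.
  by move/trivIsetP : tF => /(_ _ _ I I ij) ->; rewrite preimage_set0.
- rewrite -setI_bigcupr -preimage_bigcup.
  by apply: measurableI => //; exact: circle_preimage.
Qed.

HB.instance Definition _ := isMeasure.Build _ _ _ circle_lebesgue
  circle_lebesgue0 circle_lebesgue_ge0 circle_lebesgue_sigma_additive.

Let circle_lebesgue_setT : circle_lebesgue setT = 1.
Proof.
by rewrite /circle_lebesgue preimage_setT setIT lebesgue_measure_itv/= lte_fin
  ltr01 oppr0 adde0.
Qed.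

HB.instance Definition _ := Measure_isProbability.Build _ _ _ circle_lebesgue
  circle_lebesgue_setT.

End circle_lebesgue.

Section Z2_counting.
Local Open Scope ereal_scope.
Variable R : realType.

Definition Z2_counting : set 'Z_2 -> \bar R :=
  mscale (2^-1)%:nng%R (@counting 'Z_2 R).

HB.instance Definition _ := Measure.on Z2_counting.

Let Z2_counting_setT : Z2_counting setT = 1.
Proof.
rewrite /Z2_counting /mscale /= /counting asboolT; last exact: finite_finset.
have -> : [set: 'Z_2] = [set 0%R; 1%R].
  by apply/seteqP; split => -[[|[|//]] ?] // _; [left|right]; exact: val_inj.
by rewrite fset_setU// !fset_set1 finmap.cardfs2 /= -EFinM mulVf.
Qed.

HB.instance Definition _ := Measure_isProbability.Build _ _ _ Z2_counting
  Z2_counting_setT.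

End Z2_counting.

Definition measure_preserving d (X : measurableType d) (R : realType)
    (m : set X -> \bar R) (T : X -> X) : Prop :=
  measurable_fun setT T /\ forall B, measurable B -> m (T @^-1` B) = m B.

Definition ergodic d (X : measurableType d) (R : realType)
    (m : set X -> \bar R) (T : X -> X) : Prop :=
  forall B, measurable B -> T @^-1` B = B -> m B = 0%E \/ m (~` B) = 0%E.

(* Measurability for the sigma-algebra generated by [G]; with [G := open] this
   is Borel measurability. *)
Definition measurable_wrt d (X : measurableType d) (Y : Type)
    (G : set (set Y)) (f : X -> Y) : Prop :=
  forall B, <<s G >> B -> measurable (f @^-1` B).

Definition orthogonal_mx (R : realType) (M : 'M[R]_2) : Prop :=
  M *m M^T = 1%:M.

Fixpoint cocycle_pos (R : realType) (X : Type) (T : X -> X)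
    (A0 : X -> 'M[R]_2) (n : nat) (x : X) : 'M[R]_2 :=
  if n is m.+1 then A0 (iter m T x) *m cocycle_pos T A0 m x else 1%:M.

Fixpoint cocycle_neg (R : realType) (X : Type) (Tinv : X -> X)
    (A0 : X -> 'M[R]_2) (n : nat) (x : X) : 'M[R]_2 :=
  if n is m.+1 then invmx (A0 (iter n Tinv x)) *m cocycle_neg Tinv A0 m x
  else 1%:M.

Definition cocycle (R : realType) (X : Type) (T Tinv : X -> X)
    (A0 : X -> 'M[R]_2) (n : int) (x : X) : 'M[R]_2 :=
  match n with
  | Posz m => cocycle_pos T A0 m x
  | Negz m => cocycle_neg Tinv A0 m.+1 x
  end.

Definition mx22 (R : realType) (a b c d : R) : 'M[R]_2 :=
  \matrix_(i, j) nth 0 (nth [::] [:: [:: a; b]; [:: c; d]] i) j.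

Definition rotation_mx (R : realType) (a : R) : 'M[R]_2 :=
  mx22 (cos a) (- sin a)
       (sin a) (cos a).

(* Reflection in the line spanned by (cos b, sin b). *)
Definition reflection_mx (R : realType) (b : R) : 'M[R]_2 :=
  mx22 (cos (2 * b)) (sin (2 * b))
       (sin (2 * b)) (- cos (2 * b)).

Definition is_rotation (R : realType) (M : 'M[R]_2) : Prop :=
  exists a, M = rotation_mx a.

(* The angles are only determined modulo 2 pi, resp. modulo pi; [circle_map]
   below does not depend on the choice made here. *)
Definition rotation_angle (R : realType) (M : 'M[R]_2) : R :=
  xget 0 [set a | M = rotation_mx a].

Definition reflection_angle (R : realType) (M : 'M[R]_2) : R :=
  xget 0 [set b | M = reflection_mx b].

Definition circle_map (R : realType) (M : 'M[R]_2) (y : circle R) : circle R :=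
  if `[< is_rotation M >] then y + circle_proj (rotation_angle M / pi)
  else circle_proj (2 * reflection_angle M / pi) - y.

Definition Z2_map (R : realType) (M : 'M[R]_2) (a : 'Z_2) : 'Z_2 :=
  if `[< is_rotation M >] then a else a + 1.

Definition skew_R (R : realType) (X : Type) (T : X -> X)
    (A : int -> X -> 'M[R]_2) (p : X * 'Z_2) : X * 'Z_2 :=
  (T p.1, Z2_map (A 1 p.1) p.2).

Definition skew_S (R : realType) (X : Type) (T : X -> X)
    (A : int -> X -> 'M[R]_2) (p : X * circle R) : X * circle R :=
  (T p.1, circle_map (A 1 p.1) p.2).

(* Open sets of the Grassmannian of all subspaces of F^2, the disjoint union
   over k of the Grassmannians of k-dimensional subspaces, each carrying the
   quotient topology of the space of k-frames. *)
Definition grassmannian_open (F : numFieldType)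
    (O : set {vspace 'cV[F]_2}) : Prop :=
  forall k, @open 'M[F]_(2, k)
    [set M | free [seq col j M | j : 'I_k] /\
             O <<[seq col j M | j : 'I_k]>>%VS].

Section bundles.
Variables (d : measure_display) (X : measurableType d) (R : realType).
Variables (mu : set X -> \bar R) (T : X -> X).
Variable F : numFieldType.

(* [M] is the time-one map of the cocycle, with entries in [F]. *)
Implicit Types (M : X -> 'M[F]_2) (V W : X -> {vspace 'cV[F]_2}).

Definition invariant_bundle M V : Prop :=
  measurable_wrt (@grassmannian_open F) V /\
  exists X' : set X,
    [/\ measurable X', T @^-1` X' = X', mu (~` X') = 0%E &
        forall x, X' x -> (linfun (mulmx (M x)) @: V x)%VS = V (T x)].

Definition reducible_bundle M V : Prop :=
  exists W, invariant_bundle M W /\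
    {ae mu, forall x, [/\ W x != 0%VS, (W x <= V x)%VS & W x != V x]}.

Definition irreducible_bundle M V : Prop :=
  invariant_bundle M V /\ ~ reducible_bundle M V.

Definition trivial_bundle : X -> {vspace 'cV[F]_2} := fun=> fullv.

Definition cohomologous_to_scalar M : Prop :=
  exists (C : X -> 'M[F]_2) (lam : X -> F),
    [/\ measurable_wrt open C, forall x, C x \in unitmx,
        measurable_wrt open lam &
        {ae mu, forall x, invmx (C (T x)) *m M x *m C x = (lam x)%:M}].

End bundles.

Definition complex_mx (R : realType) (M : 'M[R]_2) : 'M[R[i]]_2 :=
  map_mx (real_complex R) M.

(* Main.v *)
Require Import Defs.
From HB Require Import structures.
From mathcomp Require Import all_boot all_order all_algebra.
From mathcomp Require Import generic_quotient ring_quotient complex ring lra.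
From mathcomp Require Import all_classical all_reals all_analysis.
From mathcomp Require Import measurable_realfun.
Import Order.TTheory GRing.Theory Num.Theory.
Import numFieldNormedType.Exports.
Local Open Scope classical_set_scope.
Local Open Scope ring_scope.
Set Implicit Arguments.
Unset Strict Implicit.
Unset Printing Implicit Defensive.

(** The theorem compares the action of the cocycle on lines of C^2 with the two
skew products.  A vector v = (a, b) of C^2 has Stokes parameters
s1 = |a|^2 - |b|^2, s2 = 2 Re(a b^* ), s3 = 2 Im(a b^* ): the coordinates of the
trace-free part of the Hermitian matrix v v^* in the basis of Pauli matrices.
They are multiplied by |l|^2 when v is multiplied by l.  When v is multiplied by
an orthogonal matrix M, the pair (s1, s2) is moved by the rotation of angle
2 alpha (or by the reflection with matrix (cos 4 beta, sin 4 beta; sin 4 beta,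
- cos 4 beta)) and s3 is multiplied by det M.  Reading a point y of the circle
as the unit vector of angle 2 pi y, that action on (s1, s2) is exactly the
fibre map of S, and the action on the sign of s3 is the fibre map of R.

Call a measurable family of vectors c(x) equivariant if A(1,x) c(x) is a
nonzero multiple of c(Tx) for x in an invariant set of full measure.  Then

- the set of (x, y) where s1 cos(2 pi y) + s2 sin(2 pi y) < 0, with s1, s2 taken
  at c(x), is S-invariant; over every x with (s1, s2) <> 0 both it and its
  complement have positive measure, so ergodicity of S forces s1 = s2 = 0 almost
  everywhere ([ergodic_S_stokes12]);
- the set of (x, a) where (-1)^a s3 < 0 is R-invariant, so ergodicity of R forces
  s3 = 0 almost everywhere ([ergodic_R_stokes3]).

A proper nonzero invariant bundle is a field of lines, and it is spanned by an
equivariant family of nonzero vectors ([reducible_equivariant_family]).  Over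
the reals s3 = 0, so S ergodic gives s1 = s2 = s3 = 0, that is c = 0, which is
impossible; over the complex numbers the same contradiction needs both R and S.
If the cocycle is cohomologous to a scalar through C, then C(x) u is equivariant
for every constant vector u ([scalar_equivariant_family]).  Hence s1 = s2 = 0, or
s3 = 0, holds on several lines at the same point x, and polarizing these
quadratic conditions gives det C(x) = 0 ([det_stokes12], [det_stokes3]). *)

(** * Orthogonal matrices of size two *)

Lemma sumsq1_cos_sin (R : realType) (c s : R) :
  c ^+ 2 + s ^+ 2 = 1 -> exists t, c = cos t /\ s = sin t.
Proof.
move=> cs1; have c1 : -1 <= c <= 1.
  rewrite -ler_norml -(@ler_pXn2r _ 2) ?nnegrE// expr1n real_normK ?num_real//.
  by rewrite -cs1 lerDl sqr_ge0.
have sE : sin (acos c) = `|s|.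
  by rewrite sin_acos// -sqrtr_sqr -cs1 [_ + s ^+ 2]addrC addrK.
have cE : cos (acos c) = c by rewrite acosK// in_itv.
have [s0|s0] := leP 0 s.
  by exists (acos c); rewrite cE sE ger0_norm.
by exists (- acos c); rewrite cosN sinN cE sE ltr0_norm// opprK.
Qed.

Lemma mx22E (R : realType) (M : 'M[R]_2) :
  M = mx22 (M 0 0) (M 0 1) (M 1 0) (M 1 1).
Proof.
apply/matrixP => i j; rewrite mxE.
by case: i => -[|[|//]] ?; case: j => -[|[|//]] ? /=; congr (M _ _);
  exact: val_inj.
Qed.

Lemma orthogonal_rotation_or_reflection (R : realType) (M : 'M[R]_2) :
  orthogonal_mx M -> is_rotation M \/ exists b, M = reflection_mx b.
Proof.
rewrite /orthogonal_mx => MMT.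
have := congr1 (fun N : 'M[R]_2 => N 0 0) MMT.
have := congr1 (fun N : 'M[R]_2 => N 0 1) MMT.
have := congr1 (fun N : 'M[R]_2 => N 1 1) MMT.
rewrite !mxE !big_ord_recl !big_ord0 !mxE /= !addr0.
have -> : lift (ord0 : 'I_2) ord0 = 1 by exact: val_inj.
have -> : (ord0 : 'I_2) = 0 by exact: val_inj.
move=> cd abcd ab; suff : let N := mx22 (M 0 0) (M 0 1) (M 1 0) (M 1 1) in
    is_rotation N \/ exists b, N = reflection_mx b.
  by rewrite /= -mx22E.
move: (M 0 0) (M 0 1) (M 1 0) (M 1 1) cd abcd ab => a b c d cd abcd ab /=.
have ac1 : a ^+ 2 + c ^+ 2 = 1.
  (* The columns of an orthogonal matrix are unit vectors as well. *)
  have bE : b ^+ 2 = 1 - a ^+ 2 by lra.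
  have dE : d ^+ 2 = 1 - c ^+ 2 by lra.
  have acE : (a * c) ^+ 2 = b ^+ 2 * d ^+ 2.
    by rewrite -exprMn -sqrrN; congr (_ ^+ 2); lra.
  by move: acE; rewrite bE dE; lra.
have [t [at_ ct]] := sumsq1_cos_sin ac1.
have [b_d|b_d] : (b = - c /\ d = a) \/ (b = c /\ d = - a).
  have : (b - c) * (b + c) = 0 by lra.
  have : (d - a) * (d + a) = 0 by lra.
  move=> /eqP; rewrite mulf_eq0 => /orP[] /eqP da /eqP;
    rewrite mulf_eq0 => /orP[] /eqP bc.
- have ac : a * c = 0.
    have bE : b = c by lra.
    have dE : d = a by lra.
    by move: abcd; rewrite bE dE; lra.
  move/eqP: ac; rewrite mulf_eq0 => /orP[]/eqP ac; [right|left]; split; lra.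
- by left; split; lra.
- by right; split; lra.
- have ac : a * c = 0.
    have bE : b = - c by lra.
    have dE : d = - a by lra.
    by move: abcd; rewrite bE dE; lra.
  move/eqP: ac; rewrite mulf_eq0 => /orP[]/eqP ac; [left|right]; split; lra.
- left; exists t; rewrite /rotation_mx -at_ -ct.
  by case: b_d => -> ->.
- right; exists (t / 2); rewrite /reflection_mx mulrCA divff// mulr1 -at_ -ct.
  by case: b_d => -> ->.
Qed.

(** * Cosine and sine on the circle R/Z *)

(** [repr] picks an arbitrary real representative; the values do not depend on
    it ([circle_cos_proj], [circle_sin_proj]). *)
Definition circle_cos (R : realType) (y : circle R) : R :=
  cos (2 * pi * repr y).
Definition circle_sin (R : realType) (y : circle R) : R :=
  sin (2 * pi * repr y).

Lemma periodic_intmul (U V : zmodType) (f : U -> V) (t : U) :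
  periodic f t -> forall (n : int) a, f (a + t *~ n) = f a.
Proof.
move=> ft [n|n] a; first exact: periodicn.
by rewrite NegzE mulrNz -[in RHS](subrK (t *~ n.+1) a); exact/esym/periodicn.
Qed.

Lemma repr_circle_proj (R : realType) (t : R) :
  exists n : int, repr (circle_proj t) = t + n%:~R.
Proof.
have : (repr (circle_proj t) = t %[mod Quotient.quot (int_subgroup R)])%qT.
  by rewrite reprK.
move/eqP; rewrite -Quotient.idealrBE => /intrP[n nE].
by exists n; rewrite -nE addrC subrK.
Qed.

Lemma circle_cos_proj (R : realType) (t : R) :
  circle_cos (circle_proj t) = cos (2 * pi * t).
Proof.
rewrite /circle_cos; have [n ->] := repr_circle_proj t.
rewrite mulrDr mulrzr mulr_natl.
exact: (periodic_intmul (@cosD2pi R)).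
Qed.

Lemma circle_sin_proj (R : realType) (t : R) :
  circle_sin (circle_proj t) = sin (2 * pi * t).
Proof.
rewrite /circle_sin; have [n ->] := repr_circle_proj t.
rewrite mulrDr mulrzr mulr_natl.
exact: (periodic_intmul (@sinD2pi R)).
Qed.

Lemma circle_projP (R : realType) (y : circle R) : exists t, y = circle_proj t.
Proof. by exists (repr y); rewrite /circle_proj reprK. Qed.

Lemma circle_projD (R : realType) (s t : R) :
  circle_proj (s + t) = circle_proj s + circle_proj t.
Proof. exact: Quotient.pi_add. Qed.

Lemma circle_projB (R : realType) (s t : R) :
  circle_proj (s - t) = circle_proj s - circle_proj t.
Proof. by rewrite circle_projD; congr (_ + _); exact: Quotient.pi_opp. Qed.

(** The sigma-algebra of the circle is the quotient one, so measurability can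
    be tested after composition with the projection. *)
Lemma measurable_circle_fun (R : realType) (f : circle R -> R) (g : R -> R) :
  measurable_fun setT g -> (forall t, f (circle_proj t) = g t) ->
  measurable_fun setT f.
Proof.
move=> mg fg _ B mB; rewrite setTI.
rewrite /measurable /= /circle_measurable /image_set_system /= setTI.
rewrite (_ : @circle_proj R @^-1` _ = g @^-1` B).
  by rewrite -[X in measurable X]setTI; exact: mg.
by apply/funext => t; rewrite /preimage /= fg.
Qed.

Lemma measurable_circle_cos (R : realType) :
  measurable_fun setT (@circle_cos R).
Proof.
apply: measurable_circle_fun (@circle_cos_proj R).
apply: (measurableT_comp (continuous_measurable_fun (@continuous_cos R))).
exact: mulrl_measurable.
Qed.

Lemma measurable_circle_sin (R : realType) :
  measurable_fun setT (@circle_sin R).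
Proof.
apply: measurable_circle_fun (@circle_sin_proj R).
apply: (measurableT_comp (continuous_measurable_fun (@continuous_sin R))).
exact: mulrl_measurable.
Qed.

(** * Stokes parameters *)

Section stokes.
Variable R : realType.
Implicit Types (v : 'cV[R[i]]_2) (M : 'M[R]_2) (y : circle R).
Local Notation Re := (@complex.Re R).
Local Notation Im := (@complex.Im R).

Definition stokes1 v : R :=
  Re (v 0 0) ^+ 2 + Im (v 0 0) ^+ 2 - (Re (v 1 0) ^+ 2 + Im (v 1 0) ^+ 2).

Definition stokes2 v : R :=
  2 * (Re (v 0 0) * Re (v 1 0) + Im (v 0 0) * Im (v 1 0)).

Definition stokes3 v : R :=
  2 * (Im (v 0 0) * Re (v 1 0) - Re (v 0 0) * Im (v 1 0)).

Definition normsq (z : R[i]) : R := Re z ^+ 2 + Im z ^+ 2.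

Lemma normsq_gt0 (z : R[i]) : z != 0 -> 0 < normsq z.
Proof.
move=> z0; rewrite lt_neqAle addr_ge0 ?sqr_ge0// andbT eq_sym.
apply: contra z0; rewrite paddr_eq0 ?sqr_ge0// !sqrf_eq0 eq_complex.
by case: z.
Qed.

Lemma stokes1Z (l : R[i]) v : stokes1 (l *: v) = normsq l * stokes1 v.
Proof.
rewrite /stokes1 /normsq !mxE; case: l => l1 l2.
by case: (v 0 0) (v 1 0) => [a1 a2] [b1 b2] /=; ring.
Qed.

Lemma stokes2Z (l : R[i]) v : stokes2 (l *: v) = normsq l * stokes2 v.
Proof.
rewrite /stokes2 /normsq !mxE; case: l => l1 l2.
by case: (v 0 0) (v 1 0) => [a1 a2] [b1 b2] /=; ring.
Qed.

Lemma stokes3Z (l : R[i]) v : stokes3 (l *: v) = normsq l * stokes3 v.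
Proof.
rewrite /stokes3 /normsq !mxE; case: l => l1 l2.
by case: (v 0 0) (v 1 0) => [a1 a2] [b1 b2] /=; ring.
Qed.

(** The Poincare sphere identity; in particular the three parameters vanish
    together only at v = 0. *)
Lemma stokes_norm v : stokes1 v ^+ 2 + stokes2 v ^+ 2 + stokes3 v ^+ 2 =
  (normsq (v 0 0) + normsq (v 1 0)) ^+ 2.
Proof.
rewrite /stokes1 /stokes2 /stokes3 /normsq.
by case: (v 0 0) (v 1 0) => [a1 a2] [b1 b2] /=; ring.
Qed.

Lemma complex_mx22_mul (a b c d : R) v :
  (complex_mx (mx22 a b c d) *m v) 0 0 = a%:C%C * v 0 0 + b%:C%C * v 1 0 /\
  (complex_mx (mx22 a b c d) *m v) 1 0 = c%:C%C * v 0 0 + d%:C%C * v 1 0.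
Proof.
by split; rewrite mxE !big_ord_recl big_ord0 addr0 !mxE /=;
  congr (_ * _ + _ * _); congr (v _ _); exact: val_inj.
Qed.

Lemma double_angle (t : R) : cos (2 * t) = cos t ^+ 2 - sin t ^+ 2 /\
  sin (2 * t) = 2 * (cos t * sin t).
Proof.
by rewrite mulr_natl mulr2n cosD sinD; split; ring.
Qed.

(** The function on X x R/Z whose sign cuts out the S-invariant set: the inner
    product of (s1, s2) with the unit vector attached to y. *)
Definition stokes_pairing v y : R :=
  stokes1 v * circle_cos y + stokes2 v * circle_sin y.

Lemma stokes_rotation (t : R) v :
  let w := complex_mx (rotation_mx t) *m v in
  [/\ stokes1 w = cos (2 * t) * stokes1 v - sin (2 * t) * stokes2 v,
      stokes2 w = sin (2 * t) * stokes1 v + cos (2 * t) * stokes2 v &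
      stokes3 w = stokes3 v].
Proof.
rewrite /= /stokes1 /stokes2 /stokes3.
have [-> ->] := complex_mx22_mul (cos t) (- sin t) (sin t) (cos t) v.
have [-> ->] := double_angle t.
case: (v 0 0) (v 1 0) => [a1 a2] [b1 b2] /=; split; try ring.
by rewrite -[RHS]mul1r -[X in _ = X * _](cos2Dsin2 t); ring.
Qed.

Lemma stokes_reflection (b : R) v :
  let w := complex_mx (reflection_mx b) *m v in
  [/\ stokes1 w = cos (2 * (2 * b)) * stokes1 v + sin (2 * (2 * b)) * stokes2 v,
      stokes2 w = sin (2 * (2 * b)) * stokes1 v - cos (2 * (2 * b)) * stokes2 v &
      stokes3 w = - stokes3 v].
Proof.
rewrite /= /stokes1 /stokes2 /stokes3.
have [-> ->] := complex_mx22_mul (cos (2 * b)) (sin (2 * b)) (sin (2 * b))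
  (- cos (2 * b)) v.
have [-> ->] := double_angle (2 * b).
case: (v 0 0) (v 1 0) => [a1 a2] [b1 b2] /=; split; try ring.
by rewrite -[RHS]mul1r -[X in _ = X * _](cos2Dsin2 (2 * b)); ring.
Qed.

Lemma rotation_angleP M : is_rotation M -> M = rotation_mx (rotation_angle M).
Proof. exact: xgetPex. Qed.

Lemma reflection_angleP M : orthogonal_mx M -> ~ is_rotation M ->
  M = reflection_mx (reflection_angle M).
Proof.
move=> /orthogonal_rotation_or_reflection[//|exb _].
exact: (@xgetPex _ 0 [set b | M = reflection_mx b]).
Qed.

(** On the doubled angles, M acts on (s1, s2) and on the unit vector attached
    to y by the same element of O_2, so the inner product is preserved. *)
Lemma stokes_pairing_invariant M v y : orthogonal_mx M ->
  stokes_pairing (complex_mx M *m v) (circle_map M y) = stokes_pairing v y.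
Proof.
move=> oM; have pi0 : pi != 0 :> R by rewrite gt_eqF ?pi_gt0.
have [t ->] := circle_projP y.
rewrite /stokes_pairing /circle_map; case: asboolP => rM.
- move: (rotation_angleP rM); set a := rotation_angle M => ->.
  have [-> -> _] := stokes_rotation a v.
  rewrite -circle_projD !circle_cos_proj !circle_sin_proj.
  have -> : 2 * pi * (t + a / pi) = 2 * pi * t + 2 * a.
    by move: pi0; generalize (pi : R) => p p0; field.
  rewrite cosD sinD -[RHS]mul1r -[X in _ = X * _](cos2Dsin2 (2 * a)); ring.
- move: (reflection_angleP oM rM); set b := reflection_angle M => ->.
  have [-> -> _] := stokes_reflection b v.
  rewrite -circle_projB !circle_cos_proj !circle_sin_proj.
  have -> : 2 * pi * (2 * b / pi - t) = 2 * (2 * b) - 2 * pi * t.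
    by move: pi0; generalize (pi : R) => p p0; field.
  rewrite cosB sinB -[RHS]mul1r -[X in _ = X * _](cos2Dsin2 (2 * (2 * b))); ring.
Qed.

(** The analogue of [stokes_pairing] for the skew product R. *)
Definition signed_stokes3 v (a : 'Z_2) : R := (-1) ^+ a * stokes3 v.

(** A reflection changes both the sign of s3 and the parity of a. *)
Lemma signed_stokes3_invariant M v (a : 'Z_2) : orthogonal_mx M ->
  signed_stokes3 (complex_mx M *m v) (Z2_map M a) = signed_stokes3 v a.
Proof.
move=> oM; rewrite /signed_stokes3 /Z2_map; case: asboolP => rM.
- have {1}-> := rotation_angleP rM.
  by have [_ _ ->] := stokes_rotation (rotation_angle M) v.
- have {1}-> := reflection_angleP oM rM.
  have [_ _ ->] := stokes_reflection (reflection_angle M) v.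
  by case: a => -[|[|//]] ? /=; rewrite ?expr0 ?expr1; ring.
Qed.

End stokes.

Arguments stokes1 {R} v.
Arguments stokes2 {R} v.
Arguments stokes3 {R} v.
Arguments stokes_pairing {R} v y.
Arguments signed_stokes3 {R} v a.

(** * Positivity of fibre measures *)

Lemma null_product_sections d1 d2 (X : measurableType d1) (Z : measurableType d2)
    (R : realType) (mu : {measure set X -> \bar R})
    (nu : {sigma_finite_measure set Z -> \bar R}) (B : set (X * Z)) (Y : set X) :
  measurable B -> (mu \x nu)%E B = 0%E -> measurable Y ->
  (forall x, Y x -> (0 < nu (xsection B x))%E) -> mu Y = 0%E.
Proof.
move=> mB B0 mY Ypos.
have mnu := measurable_fun_xsection nu mB.
have : (\int[mu]_x `|(nu \o xsection B) x|)%E = 0%E.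
  by rewrite -[RHS]B0; apply: eq_integral => x _; rewrite gee0_abs.
move/(ae_eq_integral_abs mu measurableT mnu) => null.
apply: measure_negligible => //; apply: negligibleS null => x Yx /= /(_ I) x0.
by have := Ypos x Yx; rewrite [nu _]x0 ltxx.
Qed.

(** An invariant set of an ergodic product cannot have fibres of positive
    measure, with complements of positive measure, over a base set of positive
    measure. *)
Lemma ergodic_null_base d1 d2 (X : measurableType d1) (Z : measurableType d2)
    (R : realType) (mu : {measure set X -> \bar R})
    (nu : {sigma_finite_measure set Z -> \bar R}) (S : X * Z -> X * Z)
    (B : set (X * Z)) (Y : set X) :
  ergodic (mu \x nu)%E S -> measurable B -> S @^-1` B = B -> measurable Y ->
  (forall x, Y x -> (0 < nu (xsection B x))%E) ->
  (forall x, Y x -> (0 < nu (xsection (~` B) x))%E) -> mu Y = 0%E.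
Proof.
move=> ergS mB SB mY pos posC; have [B0|B0] := ergS _ mB SB.
- exact: null_product_sections B0 mY pos.
- exact: null_product_sections (measurableC mB) B0 mY posC.
Qed.

Lemma lebesgue_measure_gt0 (R : realType) (U : set R) (t : R) :
  measurable U -> nbhs t U -> (0 < lebesgue_measure U)%E.
Proof.
move=> mU /nbhs_ballP[e /= e0 eU].
apply: (@lt_le_trans _ _ (lebesgue_measure (ball t e))).
  by rewrite lebesgue_measure_ball ?ltW// lte_fin pmulrn_lgt0.
by apply: le_measure; rewrite ?inE//; exact: measurable_ball.
Qed.

(** A nonzero combination of cosine and sine changes sign; the point 0 is
    avoided so that a whole neighbourhood of t lies in the fundamental domain
    [0, 1[. *)
Lemma sinusoid_lt0 (R : realType) (p q : R) : p ^+ 2 + q ^+ 2 != 0 ->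
  exists2 t, 0 < t < 1 & p * cos (2 * pi * t) + q * sin (2 * pi * t) < 0.
Proof.
move=> pq0.
have quarter : 2 * pi * (1 / 4) = pi / 2 :> R by generalize (pi : R) => P; field.
have three_quarters : 2 * pi * (3 / 4) = pi / 2 + pi :> R.
  by generalize (pi : R) => P; field.
have half : 2 * pi * (1 / 2) = pi :> R by generalize (pi : R) => P; field.
have eighth : 2 * pi * (1 / 8) = pi / 2 / 2 :> R.
  by generalize (pi : R) => P; field.
have [q0|q0|q0] := ltgtP q 0.
- by exists (1 / 4); rewrite ?quarter ?cos_pihalf ?sin_pihalf; lra.
- exists (3 / 4); first lra.
  by rewrite three_quarters cosDpi sinDpi cos_pihalf sin_pihalf; lra.
- have [p0|p0|p0] := ltgtP p 0.
  + exists (1 / 8); first lra.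
    rewrite eighth q0 mul0r addr0 nmulr_rlt0//.
    by apply: cos_gt0_pihalf; have := pi_gt0 R; generalize (pi : R) => P P0; lra.
  + by exists (1 / 2); rewrite ?half ?cospi ?sinpi; lra.
  + by move: pq0; rewrite p0 q0 expr0n addr0 eqxx.
Qed.

Lemma circle_lebesgue_sinusoid_gt0 (R : realType) (p q : R) :
  p ^+ 2 + q ^+ 2 != 0 ->
  (0 < circle_lebesgue
    [set y : circle R | (p * circle_cos y + q * circle_sin y < 0)%R])%E.
Proof.
move=> /sinusoid_lt0[t t01 pqt].
pose f (s : R) : R := p * cos (2 * pi * s) + q * sin (2 * pi * s).
have cf : continuous f.
  move=> s; apply: cvgD; apply: cvgM; (try exact: cvg_cst);
  [apply: (@continuous_comp _ _ _ (fun s => 2 * pi * s) cos)|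
   apply: (@continuous_comp _ _ _ (fun s => 2 * pi * s) sin)];
  by [exact: mulrl_continuous|exact: continuous_cos|exact: continuous_sin].
have ofneg : open [set s | f s < 0].
  move/continuousP : cf => /(_ [set r | r < 0]); apply; exact: open_lt.
have oU : open (`]0, 1[ `&` [set s | f s < 0] : set R).
  apply: openI; first exact: interval_open.
  exact: ofneg.
rewrite /circle_lebesgue.
rewrite [X in lebesgue_measure X](_ : _ = `[0, 1[ `&` [set s | f s < 0]); last first.
  apply/seteqP; split => s /= [s01]; rewrite circle_cos_proj circle_sin_proj//.
apply: (@lt_le_trans _ _ (lebesgue_measure (`]0, 1[ `&` [set s | f s < 0]))).
  apply: (@lebesgue_measure_gt0 _ _ t); first exact: open_measurable.
  by apply: open_nbhs_nbhs; split => //; split => //=; rewrite in_itv.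
apply: le_measure; rewrite ?inE.
- exact: open_measurable.
- apply: measurableI; first exact: measurable_itv.
  exact: open_measurable.
- by move=> s [s01 fs]; split => //; move: s01; rewrite /= !in_itv/= => /andP[/ltW-> ->].
Qed.

Lemma Z2_counting_gt0 (R : realType) (P : set 'Z_2) a :
  P a -> (0 < @Z2_counting R P)%E.
Proof.
move=> Pa; rewrite /Z2_counting /mscale /=.
rewrite mule_gt0 ?lte_fin ?invr_gt0//.
rewrite /counting asboolT; last exact: finite_finset.
rewrite lte_fin ltr0n finmap.cardfs_gt0.
apply/finmap.fset0Pn; exists a; rewrite in_fset_set ?inE//; exact: finite_finset.
Qed.

(** * Equivariant families of vectors *)

Lemma measurable_set_ltr d (X : measurableType d) (R : realType)
    (f g : X -> R) :
  measurable_fun setT f -> measurable_fun setT g ->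
  measurable [set p | f p < g p].
Proof.
move=> mf mg; rewrite -[X in measurable X]setTI.
by apply: (measurable_fun_ltr mf mg) => //.
Qed.

(** The invariant set is the part of Y x Z where K < 0; only the sign of K has
    to be preserved by S, hence the positive factor l. *)
Lemma ergodic_skew_sign d1 d2 (X : measurableType d1) (Z : measurableType d2)
    (R : realType) (mu : {measure set X -> \bar R})
    (nu : {sigma_finite_measure set Z -> \bar R}) (T : X -> X)
    (S : X * Z -> X * Z) (Y Y0 : set X) (K : X * Z -> R) :
  ergodic (mu \x nu)%E S -> (forall p, (S p).1 = T p.1) ->
  measurable Y -> T @^-1` Y = Y -> measurable_fun setT K ->
  (forall p, Y p.1 -> exists2 l, 0 < l & K p = l * K (S p)) ->
  measurable Y0 -> Y0 `<=` Y ->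
  (forall x, Y0 x -> (0 < nu [set z | (K (x, z) < 0)%R])%E) ->
  (forall x, Y0 x -> (0 < nu [set z | (0 < K (x, z))%R])%E) ->
  mu Y0 = 0%E.
Proof.
move=> ergS ST mY TY mK KS mY0 Y0Y neg pos.
pose B := [set p | Y p.1 /\ K p < 0].
have mYZ : measurable [set p : X * Z | Y p.1].
  by rewrite -[X in measurable X]setTI; exact: measurable_fst.
have mB : measurable B by apply: measurableI => //; exact: measurable_set_ltr.
have SB : S @^-1` B = B.
  apply/seteqP; split=> -[x z] [] /= Yx Kx.
  - have {}Yx : Y x by move: Yx; rewrite ST -{2}TY.
    split => //; have [l l0 ->] := KS (x, z) Yx.
    by rewrite pmulr_rlt0.
  - split; first by move: Yx; rewrite ST -{1}TY.
    by have [l l0 Kl] := KS (x, z) Yx; move: Kx; rewrite Kl pmulr_rlt0.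
apply: (ergodic_null_base ergS mB SB mY0) => x Y0x; have Yx := Y0Y _ Y0x.
- apply: lt_le_trans (neg x Y0x) _; rewrite le_eqVlt; apply/orP; left.
  apply/eqP; congr (nu _); rewrite xsectionE.
  by apply/seteqP; split => z //= [].
- apply: lt_le_trans (pos x Y0x) _; apply: le_measure; rewrite ?inE.
  + rewrite [X in measurable X](_ : _ = xsection [set p | 0 < K p] x).
      by apply: measurable_xsection; exact: measurable_set_ltr.
    by rewrite xsectionE.
  + exact/measurable_xsection/measurableC.
  + by rewrite xsectionE => z /= Kz [_ /lt_trans/(_ Kz)]; rewrite ltxx.
Qed.

Section equivariant.
Variables (d : measure_display) (X : measurableType d) (R : realType).
Variables (mu : probability X R) (T : X -> X).
Local Notation Re := (@complex.Re R).
Local Notation Im := (@complex.Im R).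
Implicit Types (c : X -> 'cV[R[i]]_2).

(** Stated on real coordinates because the Stokes parameters are real
    polynomials in them. *)
Definition measurable_vector c : Prop := forall i,
  measurable_fun setT (fun x => Re (c x i 0)) /\
  measurable_fun setT (fun x => Im (c x i 0)).

Definition equivariant_family (M : X -> 'M[R]_2) c : Prop :=
  measurable_vector c /\
  exists Y : set X, [/\ measurable Y, T @^-1` Y = Y, mu (~` Y) = 0%E &
    forall x, Y x ->
      exists2 l, l != 0 & complex_mx (M x) *m c x = l *: c (T x)].

Lemma measurable_stokes c : measurable_vector c ->
  [/\ measurable_fun setT (stokes1 \o c), measurable_fun setT (stokes2 \o c) &
      measurable_fun setT (stokes3 \o c)].
Proof.
move=> mc; have [[r0 i0] [r1 i1]] := (mc 0, mc 1).
split.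
- by apply: measurable_funB; apply: measurable_funD; exact: measurable_funX.
- by apply: measurable_funM => //; apply: measurable_funD; exact: measurable_funM.
- by apply: measurable_funM => //; apply: measurable_funB; exact: measurable_funM.
Qed.

Lemma null_on_full (Y : set X) (P : X -> Prop) :
  measurable Y -> mu (~` Y) = 0%E ->
  mu.-negligible (Y `&` [set x | ~ P x]) -> {ae mu, forall x, P x}.
Proof.
move=> mY Y0 YP.
have /negligibleU/(_ YP) : mu.-negligible (~` Y).
  by exists (~` Y); split => //; exact: measurableC.
apply: negligibleS => x /= nPx; have [Yx|nYx] := pselect (Y x); first by right.
by left.
Qed.

(** The S-invariant set is where [stokes_pairing] is negative; over a point
    with (s1, s2) <> 0 the pairing takes both signs on sets of positive
    measure. *)
Lemma ergodic_S_stokes12 (A : int -> X -> 'M[R]_2) c :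
  (forall x, orthogonal_mx (A 1 x)) ->
  ergodic (mu \x @circle_lebesgue R)%E (skew_S T A) ->
  equivariant_family (A 1) c ->
  {ae mu, forall x, stokes1 (c x) = 0 /\ stokes2 (c x) = 0}.
Proof.
move=> oA ergS [mc [Y [mY TY Y0 AY]]]; have [m1 m2 _] := measurable_stokes mc.
pose h x := stokes1 (c x) ^+ 2 + stokes2 (c x) ^+ 2.
have mh : measurable_fun setT h.
  by apply: measurable_funD; exact: measurable_funX.
have mY0 : measurable (Y `&` [set x | 0 < h x]).
  by apply: measurableI => //; exact: (measurable_set_ltr (measurable_cst (0 : R)) mh).
apply: (null_on_full mY Y0).
exists (Y `&` [set x | 0 < h x]); split => //; last first.
  move=> x [Yx /= s0]; split => //=; rewrite lt_neqAle addr_ge0 ?sqr_ge0// andbT.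
  rewrite eq_sym paddr_eq0 ?sqr_ge0// !sqrf_eq0.
  by apply/negP => /andP[/eqP ? /eqP ?]; exact: s0.
pose K (p : X * circle R) := stokes_pairing (c p.1) p.2.
apply: (ergodic_skew_sign (T := T) (Y := Y) (K := K) ergS) => //.
- rewrite /K /stokes_pairing; apply: measurable_funD; apply: measurable_funM.
  + exact: (measurableT_comp m1 measurable_fst).
  + exact: (measurableT_comp (@measurable_circle_cos R) measurable_snd).
  + exact: (measurableT_comp m2 measurable_fst).
  + exact: (measurableT_comp (@measurable_circle_sin R) measurable_snd).
- move=> [x y] /= Yx; have [l l0 Al] := AY x Yx.
  exists (normsq l); first exact: normsq_gt0.
  rewrite /K /= -(stokes_pairing_invariant (c x) y (oA x)) Al.
  by rewrite /stokes_pairing stokes1Z stokes2Z; ring.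
- move=> x [_ /= hx].
  have := @circle_lebesgue_sinusoid_gt0 R (stokes1 (c x)) (stokes2 (c x)).
  by rewrite gt_eqF//; apply.
- move=> x [_ /= hx].
  have := @circle_lebesgue_sinusoid_gt0 R (- stokes1 (c x)) (- stokes2 (c x)).
  rewrite !sqrrN gt_eqF// => /(_ isT).
  congr (0 < circle_lebesgue _)%E; apply/funext => y /=.
  by rewrite /K /stokes_pairing /= !mulNr -opprD oppr_lt0.
Qed.

(** The R-invariant set is where [signed_stokes3] is negative; over a point
    with s3 <> 0 exactly one of the two elements of Z/2 lies in it. *)
Lemma ergodic_R_stokes3 (A : int -> X -> 'M[R]_2) c :
  (forall x, orthogonal_mx (A 1 x)) ->
  ergodic (mu \x @Z2_counting R)%E (skew_R T A) ->
  equivariant_family (A 1) c -> {ae mu, forall x, stokes3 (c x) = 0}.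
Proof.
move=> oA ergR [mc [Y [mY TY Y0 AY]]]; have [_ _ m3] := measurable_stokes mc.
have mY0 : measurable (Y `&` [set x | stokes3 (c x) != 0]).
  apply: measurableI => //.
  rewrite (_ : [set x | _] =
    [set x | stokes3 (c x) < 0] `|` [set x | 0 < stokes3 (c x)]).
    apply: measurableU; first exact: (measurable_set_ltr m3 (measurable_cst (0 : R))).
    exact: (measurable_set_ltr (measurable_cst (0 : R)) m3).
  by apply/funext => x /=; rewrite neq_lt; apply/propext; split => /orP.
apply: (null_on_full mY Y0).
exists (Y `&` [set x | stokes3 (c x) != 0]); split => //; last first.
  by move=> x [Yx /= /eqP s0].
pose K (p : X * 'Z_2) := signed_stokes3 (c p.1) p.2.
apply: (ergodic_skew_sign (T := T) (Y := Y) (K := K) ergR) => //.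
- rewrite /K /signed_stokes3; apply: measurable_funM.
  + apply: (@measurableT_comp _ _ _ _ _ _ (fun a : 'Z_2 => (-1) ^+ a : R)) => //.
  + exact: (measurableT_comp m3 measurable_fst).
- move=> [x a] /= Yx; have [l l0 Al] := AY x Yx.
  exists (normsq l); first exact: normsq_gt0.
  rewrite /K /= -(signed_stokes3_invariant (c x) a (oA x)) Al.
  by rewrite /signed_stokes3 stokes3Z mulrCA.
- move=> x [_ /= s0]; have [s_lt|s_gt|/eqP] := ltgtP (stokes3 (c x)) 0.
  + by apply: (@Z2_counting_gt0 _ _ 0); rewrite /= /K /signed_stokes3 mul1r.
  + by apply: (@Z2_counting_gt0 _ _ 1); rewrite /= /K /signed_stokes3
      expr1 mulN1r oppr_lt0.
  + by rewrite (negbTE s0).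
- move=> x [_ /= s0]; have [s_lt|s_gt|/eqP] := ltgtP (stokes3 (c x)) 0.
  + by apply: (@Z2_counting_gt0 _ _ 1); rewrite /= /K /signed_stokes3
      expr1 mulN1r oppr_gt0.
  + by apply: (@Z2_counting_gt0 _ _ 0); rewrite /= /K /signed_stokes3 mul1r.
  + by rewrite (negbTE s0).
Qed.

Lemma ae_inhabited (P : X -> Prop) : {ae mu, forall x, P x} -> exists x, P x.
Proof.
move=> aeP; apply: contrapT => /forallNP nP.
have : mu [set: X] = 0%E.
  by apply: measure_negligible => //; apply: negligibleS aeP => x _; exact: nP.
by move/eqP; rewrite probability_setT onee_eq0.
Qed.

Lemma ae_conj (P Q : X -> Prop) : {ae mu, forall x, P x} ->
  {ae mu, forall x, Q x} -> {ae mu, forall x, P x /\ Q x}.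
Proof. by move=> aeP aeQ; apply: filterS2 aeP aeQ => x. Qed.

(** Remove from X the full orbit of a null set; this is where the invertibility
    of T is used. *)
Lemma ae_invariant_core (Tinv : X -> X) (P : X -> Prop) :
  cancel T Tinv -> cancel Tinv T -> measurable_fun setT Tinv ->
  measure_preserving mu T -> {ae mu, forall x, P x} ->
  exists Y, [/\ measurable Y, T @^-1` Y = Y, mu (~` Y) = 0%E & Y `<=` P].
Proof.
move=> TK TinvK mTinv [mT muT] [N [mN N0 PN]].
have mpre (f : X -> X) (B : set X) :
    measurable_fun setT f -> measurable B -> measurable (f @^-1` B).
  by move=> mf mB; rewrite -[X in measurable X]setTI; exact: mf.
have muTinv B : measurable B -> mu (Tinv @^-1` B) = mu B.
  move=> mB; rewrite -muT; last exact: mpre.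
  by congr (mu _); apply/funext => x; rewrite /preimage /= TK.
have iter_null (f : X -> X) : measurable_fun setT f ->
    (forall B, measurable B -> mu (f @^-1` B) = mu B) ->
    forall n, measurable (iter n f @^-1` N) /\ mu (iter n f @^-1` N) = 0%E.
  move=> mf muf; elim => [|n [mn n0]]; first by rewrite /preimage.
  have -> : iter n.+1 f @^-1` N = f @^-1` (iter n f @^-1` N).
    by apply/funext => x; rewrite /preimage /= -iterSr.
  by split; [exact: mpre|rewrite muf].
pose E := \bigcup_n (iter n T @^-1` N `|` iter n Tinv @^-1` N).
have mE : measurable E.
  apply: bigcupT_measurable => n.
  by apply: measurableU; [exact: (iter_null T mT muT n).1|
                          exact: (iter_null Tinv mTinv muTinv n).1].
exists (~` E); split.
- exact: measurableC.
- apply/seteqP; split => x /= nE [n _ H]; apply: nE.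
  + case: H => [|H].
    * case: n => [Nx|n]; first by exists 1%N => //; right; rewrite /= TK.
      by rewrite /= -iterS iterSr => H; exists n => //; left.
    * by exists n.+1 => //; right; rewrite /preimage /= -iterS iterSr TK.
  + case: H => H.
    * by exists n.+1 => //; left; rewrite /preimage /= -iterS iterSr.
    * case: n H => [/= NTx|n]; first by exists 1%N => //; left.
      by rewrite /preimage -[X in X -> _]/(N _) iterSr TK => H; exists n => //; right.
- rewrite setCK; apply: measure_negligible => //.
  apply: negligible_bigcup => n; apply: negligibleU.
  + by have [? ?] := iter_null T mT muT n;
    eexists; split; last exact: subset_refl.
  + by have [? ?] := iter_null Tinv mTinv muTinv n;
    eexists; split; last exact: subset_refl.
- move=> x nEx; apply: contrapT => nPx; apply: nEx; exists 0%N => //; left.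
  exact: PN.
Qed.

End equivariant.

(** * Measurable fields of lines *)

Lemma measurable_fun_rays d (X : measurableType d) (R : realType) (f : X -> R) :
  (forall r, measurable [set x | r < f x]) -> measurable_fun setT f.
Proof.
move=> mf; apply: (measurability _ (RGenOInfty.measurableE R)) => //.
by move=> _ [_ [r ->] <-]; rewrite setTI preimage_itvoy.
Qed.

Section lines.
Variable F : numFieldType.
Implicit Types (V : {vspace 'cV[F]_2}) (s : F) (U : set F).

Definition slope_vec s : 'cV[F]_2 := \col_i (if i == 0 then 1 else s).
Definition vertical_vec : 'cV[F]_2 := \col_i (if i == 0 then 0 else 1).

Definition lines_with_slope_in U : set {vspace 'cV[F]_2} :=
  [set V | exists2 s, U s & V = <[slope_vec s]>%VS].

(** A spanning vector of the line V, normalized to (1, s) when V is not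
    vertical, so that it depends measurably on V. *)
Definition line_section V : 'cV[F]_2 :=
  if pselect (exists s, V = <[slope_vec s]>%VS) is left _
  then slope_vec (xget 0 [set s | V = <[slope_vec s]>%VS]) else vertical_vec.

Lemma slope_vec_neq0 s : slope_vec s != 0.
Proof.
by apply/eqP => /matrixP/(_ 0 0)/eqP; rewrite !mxE /= oner_eq0.
Qed.

Lemma line_section_neq0 V : line_section V != 0.
Proof.
rewrite /line_section; case: pselect => _; first exact: slope_vec_neq0.
by apply/eqP => /matrixP/(_ 1 0)/eqP; rewrite !mxE /= oner_eq0.
Qed.

Lemma slope_vec_inj s t : <[slope_vec s]>%VS = <[slope_vec t]>%VS -> s = t.
Proof.
move=> st; have /vlineP[k /matrixP sk] : slope_vec s \in <[slope_vec t]>%VS.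
  by rewrite -st memv_line.
have := sk 0 0; have := sk 1 0; rewrite !mxE /= mulr1 => -> <-.
by rewrite mul1r.
Qed.

Lemma cV2_slope (v : 'cV[F]_2) :
  v 0 0 != 0 -> v = v 0 0 *: slope_vec (v 1 0 / v 0 0).
Proof.
move=> v0; apply/matrixP => i j; rewrite !ord1 !mxE.
case: i => -[|[|//]] lti /=.
  by rewrite mulr1; congr (v _ _); exact: val_inj.
by rewrite mulrCA divff// mulr1; congr (v _ _); exact: val_inj.
Qed.

Lemma cV2_vertical (v : 'cV[F]_2) : v 0 0 = 0 -> v = v 1 0 *: vertical_vec.
Proof.
move=> v0; apply/matrixP => i j; rewrite !ord1 !mxE.
case: i => -[|[|//]] lti /=.
  by rewrite mulr0 -v0; congr (v _ _); exact: val_inj.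
by rewrite mulr1; congr (v _ _); exact: val_inj.
Qed.

Lemma vline_scale (k : F) (v : 'cV[F]_2) : k != 0 -> <[k *: v]>%VS = <[v]>%VS.
Proof.
move=> k0; apply/eqP; rewrite eqEdim !dim_vline scaler_eq0 (negbTE k0) leqnn andbT.
by rewrite -memvE memvZ ?memv_line.
Qed.

Lemma line_sectionP V : V != 0%VS -> V != fullv -> V = <[line_section V]>%VS.
Proof.
move=> V0 VT; pose v := vpick V.
have v0 : v != 0 by rewrite vpick0.
have dV : \dim V = 1%N.
  apply/eqP; rewrite eqn_leq lt0n dimv_eq0 V0 andbT.
  have : (\dim V < \dim (fullv : {vspace 'cV[F]_2}))%N.
    by rewrite ltnNge; apply: contra VT => le2; rewrite eqEdim subvf.
  by rewrite dimvf /dim /=.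
have Vv : V = <[v]>%VS.
  apply/eqP; rewrite eq_sym eqEdim dim_vline v0 dV leqnn andbT.
  by rewrite -memvE memv_pick.
rewrite /line_section; case: pselect => [exs|noslope].
  exact: (@xgetPex _ 0 [set s | V = <[slope_vec s]>%VS]).
have [v00|v00] := eqVneq (v 0 0) 0.
  have vE := cV2_vertical v00; rewrite {1}Vv {1}vE vline_scale//.
  by apply: contra v0 => /eqP v10; rewrite vE v10 scale0r.
by case: noslope; exists (v 1 0 / v 0 0); rewrite Vv {1}(cV2_slope v00) vline_scale.
Qed.

Lemma line_sectionE V : lines_with_slope_in setT V ->
  exists2 s, V = <[slope_vec s]>%VS & line_section V = slope_vec s.
Proof.
move=> [s _ Vs]; exists s => //; rewrite /line_section.
case: pselect => [exs|[]]; last by exists s.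
congr slope_vec; apply: slope_vec_inj; rewrite -Vs; apply/esym.
exact: (@xgetPex _ 0 [set s | V = <[slope_vec s]>%VS]).
Qed.

Lemma line_section_vertical V : ~ lines_with_slope_in setT V ->
  line_section V = vertical_vec.
Proof.
rewrite /line_section; case: pselect => // -[s Vs] []; by exists s.
Qed.

(** A line is not the span of a free k-frame unless k = 1; for k = 1 the frame
    is one vector and the slope is the quotient of its entries. *)
Lemma grassmannian_open_slope U :
  open U -> grassmannian_open (lines_with_slope_in U).
Proof.
move=> oU [|[|k]].
- rewrite (_ : [set M | _] = set0); first exact: open0.
  apply/seteqP; split => // M [_ [s _]]; rewrite /image_mem enum_ord0 /= span_nil.
  by move/eqP; rewrite eq_sym -dimv_eq0 dim_vline slope_vec_neq0.
- rewrite (_ : [set M | _] = [set M : 'M[F]_(2, 1) |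
      M 0 0 != 0 /\ U (M 1 0 / M 0 0)]).
    rewrite openE => M [M0 UM]; rewrite /interior.
    have c00 : {for M, continuous (fun N : 'M[F]_(2, 1) => N 0 0)}.
      exact: coord_continuous.
    have c10 : {for M, continuous (fun N : 'M[F]_(2, 1) => N 1 0)}.
      exact: coord_continuous.
    have cq : {for M, continuous (fun N : 'M[F]_(2, 1) => N 1 0 / N 0 0)}.
      by apply: continuousM => //; apply: continuousV.
    have n0 : \forall N \near (M : 'M[F]_(2, 1)), (N : 'M[F]_(2, 1)) 0 0 != 0.
      exact: cvgr_neq0 c00 M0.
    have nU : \forall N \near (M : 'M[F]_(2, 1)),
        U ((N : 'M[F]_(2, 1)) 1 0 / (N : 'M[F]_(2, 1)) 0 0).
      by apply: (cq U); apply: open_nbhs_nbhs.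
    by apply: filterS2 n0 nU.
  have imE (M : 'M[F]_(2, 1)) : [seq col j M | j : 'I_1] = [:: col 0 M].
    by rewrite /image_mem enum_ordSl enum_ord0 /=; congr [:: col _ _]; exact: val_inj.
  have colE (M : 'M[F]_(2, 1)) i : (col 0 M) i 0 = M i 0 by rewrite mxE.
  apply/seteqP; split => M /=; rewrite imE span_seq1 seq1_free.
  + move=> [M0 [s Us Ms]].
    have /vlineP[k Mk] : col 0 M \in <[slope_vec s]>%VS by rewrite -Ms memv_line.
    have k0 : k != 0 by apply: contra M0 => /eqP k0; rewrite Mk k0 scale0r.
    have M00 : M 0 0 = k by rewrite -colE Mk !mxE mulr1.
    have M10 : M 1 0 = k * s by rewrite -colE Mk !mxE.
    by rewrite M00 M10 mulrAC divff// mul1r.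
  + move=> [M0 UM]; split.
      by apply: contra M0 => /eqP M0; rewrite -colE M0 mxE.
    exists (M 1 0 / M 0 0) => //.
    by rewrite [X in <[X]>%VS]cV2_slope ?colE// vline_scale.
- rewrite (_ : [set M | _] = set0); first exact: open0.
  apply/seteqP; split => // M [fM [s _]] => /(congr1 (fun V => \dim V)).
  by rewrite (eqP fM) dim_vline slope_vec_neq0 size_map size_enum_ord.
Qed.

(** On non-vertical lines the section is read off from the slope, so a strict
    lower bound on h amounts to a slope in an open set; on the other subspaces
    the section is constant. *)
Lemma measurable_line_section d (X : measurableType d) (R : realType)
    (W : X -> {vspace 'cV[F]_2}) (h : F -> R) i :
  measurable_wrt (@grassmannian_open F) W ->
  (forall r, open [set z | r < h z]) ->
  measurable_fun setT (fun x => h (line_section (W x) i 0)).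
Proof.
move=> mW oh; apply: measurable_fun_rays => r.
pose U := [set s | r < h (slope_vec s i 0)].
have oU : open U.
  have [i0|i0] := eqVneq i 0.
    rewrite (_ : U = [set _ | r < h 1]).
      have [rh|rh] := boolP (r < h 1).
        by rewrite (_ : [set _ | _] = setT); [exact: openT|apply/seteqP; split].
      by rewrite (_ : [set _ | _] = set0); [exact: open0|apply/seteqP; split].
    by apply/funext => s; rewrite /U /= mxE i0 eqxx.
  rewrite (_ : U = [set z | r < h z]); first exact: oh.
  by apply/funext => s; rewrite /U /= mxE (negbTE i0).
have mS (V : set F) : open V -> measurable (W @^-1` lines_with_slope_in V).
  by move=> oV; apply: mW; apply: sub_sigma_algebra; exact: grassmannian_open_slope.
rewrite (_ : [set x | _] = W @^-1` lines_with_slope_in U `|`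
    (~` (W @^-1` lines_with_slope_in setT) `&`
     [set x | r < h (vertical_vec i 0)])).
  apply: measurableU; first exact: mS.
  apply: measurableI; first by apply: measurableC; apply: mS; exact: openT.
  have [rh|rh] := boolP (r < h (vertical_vec i 0)).
    by rewrite (_ : [set x | _] = setT); [exact: measurableT|apply/seteqP; split].
  by rewrite (_ : [set x | _] = set0); [exact: measurable0|apply/seteqP; split].
apply/seteqP; split => x /=.
- have [sl|nsl] := pselect (lines_with_slope_in setT (W x)).
    by have [s Ws ->] := line_sectionE sl => rs; left; exists s.
  by rewrite line_section_vertical//; right.
- move=> [[s Us Ws]|[nsl]]; last by rewrite line_section_vertical.
  have [|t Wt ->] := @line_sectionE (W x); first by exists s.
  by have -> : t = s by apply: slope_vec_inj; rewrite -Wt.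
Qed.

End lines.

Section reducible.
Variables (d : measure_display) (X : measurableType d) (R : realType).
Variables (mu : probability X R) (T Tinv : X -> X).
Hypotheses (TK : cancel T Tinv) (TinvK : cancel Tinv T).
Hypotheses (mTinv : measurable_fun setT Tinv) (T_mp : measure_preserving mu T).
Local Notation Re := (@complex.Re R).
Local Notation Im := (@complex.Im R).

(** The real and the complex case are treated together: iota is the embedding
    of R in R[i], or the identity of R[i]. *)
Lemma reducible_equivariant_family (F : numFieldType)
    (iota : {rmorphism F -> R[i]}) (M : X -> 'M[R]_2) (MF : X -> 'M[F]_2) :
  (forall r, open [set z | r < Re (iota z)]) ->
  (forall r, open [set z | r < Im (iota z)]) ->
  (forall x, map_mx iota (MF x) = complex_mx (M x)) ->
  reducible_bundle mu T MF (@trivial_bundle _ X F) ->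
  exists w : X -> 'cV[F]_2, (forall x, w x != 0) /\
    equivariant_family mu T M (fun x => map_mx iota (w x)).
Proof.
move=> oRe oIm MFM [W [[mW [X' [mX' TX' X'0 X'W]]] aeW]].
exists (fun x => line_section (W x)); split => [x|].
  exact: line_section_neq0.
split=> [i|].
  split.
    rewrite (_ : (fun x => _) = (fun x => (Re \o iota) (line_section (W x) i 0))).
      exact: measurable_line_section.
    by apply/funext => x; rewrite mxE.
  rewrite (_ : (fun x => _) = (fun x => (Im \o iota) (line_section (W x) i 0))).
    exact: measurable_line_section.
  by apply/funext => x; rewrite mxE.
have aeX' : {ae mu, forall x, X' x}.
  by exists (~` X'); split => //; exact: measurableC.
have : {ae mu, forall x, X' x /\ W x = <[line_section (W x)]>%VS}.
  apply: filterS2 aeX' aeW => x X'x [W0 _ WT]; split => //.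
  exact: line_sectionP.
move=> /(ae_invariant_core TK TinvK mTinv T_mp)[Y [mY TY Y0 YW]].
exists Y; split => // x Yx.
have [X'x Wx] := YW x Yx.
have [_ WTx] : X' (T x) /\ W (T x) = <[line_section (W (T x))]>%VS.
  by apply: YW; rewrite -TY in Yx.
have := X'W x X'x; rewrite {1}Wx limg_line lfunE /=.
set v := line_section (W x); set w := line_section (W (T x)).
rewrite WTx -/w => Mvw.
have /vlineP[l Mv] : MF x *m v \in <[w]>%VS by rewrite -Mvw memv_line.
exists (iota l).
  (* If l = 0 then W(x) is mapped to 0, whereas W(Tx) is spanned by w <> 0. *)
  rewrite fmorph_eq0; apply/eqP => l0.
  have : w \in <[MF x *m v]>%VS by rewrite Mvw memv_line.
  rewrite Mv l0 scale0r => /vlineP[k]; rewrite scaler0 => /eqP.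
  by rewrite (negbTE (line_section_neq0 _)).
by rewrite -MFM -map_mxM Mv map_mxZ.
Qed.

End reducible.

(** * Half-planes are open *)

Section complex_topology.
Variable R : realType.
Local Notation C := (Num.NumField.sort (R[i] : numFieldType)).

Lemma open_complex_gt (f : R[i] -> R) :
  (forall z w, f z - f w <= complex.Re `|z - w|) ->
  forall r, open [set z : C | r < f z].
Proof.
move=> f_lip r; rewrite openE => z /= rz; apply/nbhs_ballP.
exists (f z - r)%:C%C => /=; first by rewrite -(rmorph0 (real_complex R)) ltcR subr_gt0.
move=> w; rewrite -ball_normE /= => zw.
have zwR : complex.Re `|z - w| < f z - r.
  by move: zw; rewrite normc_def ltcR.
by rewrite -(ltrD2l (f z)) -ltrBlDr; move: (f_lip z w) zwR; lra.
Qed.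

Lemma open_Re_gt (r : R) : open [set z : C | r < complex.Re z].
Proof.
apply: open_complex_gt => z w; have := normc_ge_Re (z - w).
rewrite normc_def lecR /= => /(le_trans (ler_norm _)).
by case: z w => [? ?] [? ?].
Qed.

Lemma open_Im_gt (r : R) : open [set z : C | r < complex.Im z].
Proof.
apply: open_complex_gt => z w; rewrite normc_def /=.
apply: (le_trans (ler_norm _)).
rewrite -sqrtr_sqr; apply: ler_wsqrtr.
by case: z w => [a b] [a' b'] /=; rewrite lerDr sqr_ge0.
Qed.

End complex_topology.

(** * Invariant bundles, scalar cocycles and polarization *)

Section scalar_cocycles.
Variables (R : realType) (d : measure_display) (X : measurableType d).
Variables (mu : probability X R) (T Tinv : X -> X).
Local Notation Re := (@complex.Re R).
Local Notation Im := (@complex.Im R).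
Local Notation Cx := (Num.NumField.sort (R[i] : numFieldType)).

Lemma invariant_trivial_bundle (F : numFieldType) (M : X -> 'M[F]_2) :
  (forall x, M x \in unitmx) -> invariant_bundle mu T M (@trivial_bundle _ X F).
Proof.
move=> uM; split.
  move=> B _; have [BT|BT] := pselect (B fullv).
    by rewrite (_ : _ @^-1` B = setT); [exact: measurableT|apply/seteqP; split].
  by rewrite (_ : _ @^-1` B = set0); [exact: measurable0|apply/seteqP; split].
exists setT; split => //; first by rewrite setCT measure0.
move=> x _; apply: lker0_limgf; apply/lker0P => u v; rewrite !lfunE /=.
exact: (can_inj (mulKmx (uM x))).
Qed.

Lemma orthogonal_unitmx (M : 'M[R]_2) : orthogonal_mx M -> M \in unitmx.
Proof. by move=> /mulmx1_unit[]. Qed.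

Lemma normsq_eq0 (z : R[i]) : normsq z = 0 -> z = 0.
Proof.
by move=> z0; apply/eqP; apply: contraT => /normsq_gt0; rewrite z0 ltxx.
Qed.

Lemma stokes_eq0 (v : 'cV[R[i]]_2) :
  stokes1 v = 0 -> stokes2 v = 0 -> stokes3 v = 0 -> v = 0.
Proof.
move=> s1 s2 s3; have := stokes_norm v; rewrite s1 s2 s3 !expr0n !addr0.
move/esym/eqP; rewrite sqrf_eq0 paddr_eq0 ?addr_ge0 ?sqr_ge0//.
move=> /andP[/eqP/normsq_eq0 v0 /eqP/normsq_eq0 v1].
apply/matrixP => i j; rewrite ord1 mxE.
by case: i => -[|[|//]] lti; [rewrite -[RHS]v0|rewrite -[RHS]v1];
  congr (v _ _); exact: val_inj.
Qed.

Lemma stokes3_real (w : 'cV[R]_2) : stokes3 (map_mx (real_complex R) w) = 0.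
Proof. by rewrite /stokes3 !mxE /= mulr0 mul0r subrr mulr0. Qed.

Lemma measurable_mx_entry (C : X -> 'M[Cx]_2) (h : R[i] -> R) i j :
  measurable_wrt open C -> (forall r, open [set z : Cx | r < h z]) ->
  measurable_fun setT (fun x => h (C x i j)).
Proof.
move=> mC oh; apply: measurable_fun_rays => r.
apply: (mC [set N : 'M[Cx]_2 | r < h (N i j)]); apply: sub_sigma_algebra.
have := @coord_continuous R[i] 2 2 i j.
by move/continuousP => /(_ _ (oh r)).
Qed.

Lemma scalar_equivariant_family (M : X -> 'M[R]_2) (C : X -> 'M[Cx]_2)
    (lam : X -> R[i]) (u : 'cV[R[i]]_2) :
  cancel T Tinv -> cancel Tinv T -> measurable_fun setT Tinv ->
  measure_preserving mu T -> (forall x, M x \in unitmx) ->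
  measurable_wrt open C -> (forall x, C x \in unitmx) ->
  {ae mu, forall x, invmx (C (T x)) *m complex_mx (M x) *m C x = (lam x)%:M} ->
  equivariant_family mu T M (fun x => C x *m u).
Proof.
move=> TK TinvK mTinv T_mp uM mC uC aeC; split.
  move=> i; have mre j := measurable_mx_entry i j mC (@open_Re_gt R).
  have mim j := measurable_mx_entry i j mC (@open_Im_gt R).
  split.
    rewrite (_ : (fun x => _) = (fun x =>
      (Re (C x i 0) * Re (u 0 0) - Im (C x i 0) * Im (u 0 0)) +
      (Re (C x i 1) * Re (u 1 0) - Im (C x i 1) * Im (u 1 0)))).
      by apply: measurable_funD; apply: measurable_funB; apply: measurable_funM.
    apply/funext => x; rewrite mxE !big_ord_recl big_ord0 addr0.
    have -> : lift ord0 ord0 = 1 :> 'I_2 by exact: val_inj.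
    by case: (C x i 0) (u 0 0) (C x i 1) (u 1 0) => [? ?] [? ?] [? ?] [? ?].
  rewrite (_ : (fun x => _) = (fun x =>
    (Re (C x i 0) * Im (u 0 0) + Im (C x i 0) * Re (u 0 0)) +
    (Re (C x i 1) * Im (u 1 0) + Im (C x i 1) * Re (u 1 0)))).
    by apply: measurable_funD; apply: measurable_funD; apply: measurable_funM.
  apply/funext => x; rewrite mxE !big_ord_recl big_ord0 addr0.
  have -> : lift ord0 ord0 = 1 :> 'I_2 by exact: val_inj.
  by case: (C x i 0) (u 0 0) (C x i 1) (u 1 0) => [? ?] [? ?] [? ?] [? ?].
have [Y [mY TY Y0 YC]] := ae_invariant_core TK TinvK mTinv T_mp aeC.
exists Y; split => // x /YC MC; exists (lam x).
  apply/eqP => l0; move: MC; rewrite l0 => MC.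
  have : invmx (C (T x)) *m complex_mx (M x) *m C x \in unitmx.
    by rewrite !unitmx_mul unitmx_inv !uC map_unitmx uM.
  by rewrite MC -scalemx1 scale0r unitmxE det0 unitr0.
rewrite mulmxA -[complex_mx _ *m _](mulKVmx (uC (T x))) (mulmxA (invmx _)) MC.
by rewrite mul_mx_scalar scalemxAl.
Qed.

Definition cvec (a b : R[i]) : 'cV[R[i]]_2 := \col_i (if i == 0 then a else b).

Lemma mul_cvec (C : 'M[R[i]]_2) (a b : R[i]) i :
  (C *m cvec a b) i 0 = C i 0 * a + C i 1 * b.
Proof.
rewrite mxE !big_ord_recl big_ord0 addr0 !mxE /=.
by congr (_ * _ + _ * _); congr (C _ _); exact: val_inj.
Qed.

Lemma det_mx22 (K : comNzRingType) (C : 'M[K]_2) :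
  \det C = C 0 0 * C 1 1 - C 0 1 * C 1 0.
Proof.
rewrite (expand_det_row _ 0) !big_ord_recl big_ord0 addr0 /cofactor !det_mx11.
rewrite !mxE /= expr0 expr1 mul1r mulN1r mulrN.
by congr (_ * C _ _ - C _ _ * C _ _); exact: val_inj.
Qed.

(** |a^2 + b^2|^2 = s1^2 + s2^2, so s1 = s2 = 0 says that v is isotropic for
    the complex bilinear dot product. *)
Lemma stokes12_isotropic (v : 'cV[R[i]]_2) :
  stokes1 v = 0 -> stokes2 v = 0 -> v 0 0 ^+ 2 + v 1 0 ^+ 2 = 0.
Proof.
move=> s1 s2; apply: normsq_eq0.
have : normsq (v 0 0 ^+ 2 + v 1 0 ^+ 2) = stokes1 v ^+ 2 + stokes2 v ^+ 2.
  rewrite /normsq /stokes1 /stokes2.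
  by case: (v 0 0) (v 1 0) => [a1 a2] [b1 b2] /=; ring.
by rewrite s1 s2 !expr0n addr0.
Qed.

(** The columns of C and their sum are isotropic, so by polarization the
    columns are also orthogonal to each other: C^T C = 0. *)
Lemma det_stokes12 (C : 'M[R[i]]_2) :
  (forall u, u \in [:: cvec 1 0; cvec 0 1; cvec 1 1] ->
     stokes1 (C *m u) = 0 /\ stokes2 (C *m u) = 0) -> \det C = 0.
Proof.
move=> s.
have e1 : C 0 0 ^+ 2 + C 1 0 ^+ 2 = 0.
  have [|s1 s2] := s (cvec 1 0); first by rewrite !inE eqxx.
  by have := stokes12_isotropic s1 s2; rewrite !mul_cvec !mulr1 !mulr0 !addr0.
have e2 : C 0 1 ^+ 2 + C 1 1 ^+ 2 = 0.
  have [|s1 s2] := s (cvec 0 1); first by rewrite !inE eqxx orbT.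
  by have := stokes12_isotropic s1 s2; rewrite !mul_cvec !mulr1 !mulr0 !add0r.
have e3 : (C 0 0 + C 0 1) ^+ 2 + (C 1 0 + C 1 1) ^+ 2 = 0.
  have [|s1 s2] := s (cvec 1 1); first by rewrite !inE eqxx !orbT.
  by have := stokes12_isotropic s1 s2; rewrite !mul_cvec !mulr1.
have e4 : 2 * (C 0 0 * C 0 1 + C 1 0 * C 1 1) = 0.
  transitivity ((C 0 0 + C 0 1) ^+ 2 + (C 1 0 + C 1 1) ^+ 2
    - (C 0 0 ^+ 2 + C 1 0 ^+ 2) - (C 0 1 ^+ 2 + C 1 1 ^+ 2)); first by ring.
  by rewrite e1 e2 e3 !subr0.
have {}e4 : C 0 0 * C 0 1 + C 1 0 * C 1 1 = 0.
  by move/eqP: e4; rewrite mulf_eq0 pnatr_eq0 => /eqP.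
apply/eqP; rewrite -sqrf_eq0; apply/eqP.
rewrite det_mx22.
(* Lagrange's identity: det (C^T C) = (det C)^2. *)
transitivity ((C 0 0 ^+ 2 + C 1 0 ^+ 2) * (C 0 1 ^+ 2 + C 1 1 ^+ 2)
  - (C 0 0 * C 0 1 + C 1 0 * C 1 1) ^+ 2); first by ring.
by rewrite e1 e4 mul0r expr0n subr0.
Qed.

(** The form s3 is Hermitian of signature (1, 1). The four values determine its
    Gram matrix on the columns of C, whose determinant is - |det C|^2. *)
Lemma det_stokes3 (C : 'M[R[i]]_2) :
  stokes3 (C *m cvec 1 0) = 0 -> stokes3 (C *m cvec 0 1) = 0 ->
  stokes3 (C *m cvec 1 1) = 0 -> stokes3 (C *m cvec 1 'i%C) = 0 -> \det C = 0.
Proof.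
move=> s1 s2 s3 s4; apply: normsq_eq0.
have : 4 * normsq (\det C) =
  (stokes3 (C *m cvec 1 1) - stokes3 (C *m cvec 1 0) - stokes3 (C *m cvec 0 1)) ^+ 2 +
  (stokes3 (C *m cvec 1 'i%C) - stokes3 (C *m cvec 1 0) - stokes3 (C *m cvec 0 1)) ^+ 2
  - 4 * stokes3 (C *m cvec 1 0) * stokes3 (C *m cvec 0 1).
  rewrite det_mx22 /stokes3 /normsq !mul_cvec.
  case: (C 0 0) (C 0 1) (C 1 0) (C 1 1) => [a1 a2] [b1 b2] [c1 c2] [d1 d2] /=.
  by ring.
rewrite s1 s2 s3 s4; lra.
Qed.

End scalar_cocycles.

(** * Irreducibility *)

Theorem theorem3p1 (R : realType) (d : measure_display) (X : measurableType d)
    (mu : probability X R) (T Tinv : X -> X) (A0 : X -> 'M[R]_2)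
    (TK : cancel T Tinv) (TinvK : cancel Tinv T)
    (mTinv : measurable_fun setT Tinv)
    (T_mp : measure_preserving mu T) (T_erg : ergodic mu T)
    (mA0 : measurable_wrt open A0) (oA0 : forall x, orthogonal_mx (A0 x)) :
  let A := cocycle T Tinv A0 in
  let R_ergodic := ergodic (mu \x @Z2_counting R)%E (skew_R T A) in
  let S_ergodic := ergodic (mu \x @circle_lebesgue R)%E (skew_S T A) in
  [/\ S_ergodic -> irreducible_bundle mu T (A 1) (@trivial_bundle _ X R),
      R_ergodic /\ S_ergodic ->
        irreducible_bundle mu T (fun x => complex_mx (A 1 x))
          (@trivial_bundle _ X R[i]) &
      R_ergodic \/ S_ergodic ->
        ~ cohomologous_to_scalar mu T (fun x => complex_mx (A 1 x))].
Proof.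
move=> A R_ergodic S_ergodic.
have oA x : orthogonal_mx (A 1 x) by rewrite /A /cocycle /= mulmx1.
have uA x : A 1 x \in unitmx := orthogonal_unitmx (oA x).
have uAC x : complex_mx (A 1 x) \in unitmx by rewrite map_unitmx.
split.
- move=> ergS; split; first exact: invariant_trivial_bundle.
  move=> redA.
  have := reducible_equivariant_family (iota := real_complex R) TK TinvK mTinv T_mp
    (M := A 1) (@open_gt _) _ _ redA.
  case=> [r||w [w0 eqw]].
  + (* The imaginary part of a real number is 0, whence a constant condition. *)
    have [r0|r0] := boolP (r < 0).
      by rewrite (_ : [set _ | _] = setT); [exact: openT|apply/seteqP; split].
    by rewrite (_ : [set _ | _] = set0); [exact: open0|apply/seteqP; split].
  + by [].
  have [x [s1 s2]] := ae_inhabited (ergodic_S_stokes12 oA ergS eqw).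
  have /eqP := stokes_eq0 s1 s2 (stokes3_real (w x)).
  by rewrite map_mx_eq0 (negbTE (w0 x)).
- move=> [ergR ergS]; split; first exact: invariant_trivial_bundle.
  move=> redA.
  have := reducible_equivariant_family (iota := idfun) TK TinvK mTinv T_mp
    (M := A 1) (@open_Re_gt R) (@open_Im_gt R) _ redA.
  case=> [x|w [w0 eqw]]; first by rewrite map_mx_id.
  have [x [[s1 s2] s3]] := ae_inhabited
    (ae_conj (ergodic_S_stokes12 oA ergS eqw)
       (ergodic_R_stokes3 oA ergR eqw)).
  have /eqP := stokes_eq0 s1 s2 s3.
  by rewrite map_mx_eq0 (negbTE (w0 x)).
- move=> ergRS [C [lam [mC uC mlam aeC]]].
  have eqC u := scalar_equivariant_family u TK TinvK mTinv T_mp uA mC uC aeC.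
  have detC x : \det (C x) != 0 by have := uC x; rewrite unitmxE unitfE.
  case: ergRS => [ergR|ergS].
  + have s3 u := ergodic_R_stokes3 oA ergR (eqC u).
    have [x [[h1 h2] [h3 h4]]] := ae_inhabited
      (ae_conj
        (ae_conj (s3 (cvec 1 0)) (s3 (cvec 0 1)))
        (ae_conj (s3 (cvec 1 1)) (s3 (cvec 1 'i%C)))).
    by have := detC x; rewrite (det_stokes3 h1 h2 h3 h4) eqxx.
  + have s12 u := ergodic_S_stokes12 oA ergS (eqC u).
    have [x [h1 [h2 h3]]] := ae_inhabited
      (ae_conj (s12 (cvec 1 0))
        (ae_conj (s12 (cvec 0 1)) (s12 (cvec 1 1)))).
    have := detC x; rewrite det_stokes12 ?eqxx// => u.
    by rewrite !inE => /or3P[] /eqP ->.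
Qed.
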